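(* Assume: (H') for every bounded interval $J\subset I$ there exist a positive $\psi\in C^2(\mathbb R^d)$ with $\psi(x)\to+\infty$ as $|x|\to\infty$ and $\lambda\in\mathbb R$ with $\mathcal A_{-c}(t)\psi-\lambda\psi\le0$ on $J\times\mathbb R^d$; and (H'') for every bounded interval $J\subset I$ there exist a positive $\varphi_J\in C^2(\mathbb R^d)$ with $\varphi_J(x)\to+\infty$ as $|x|\to\infty$ and $M_J>0$ with $\mathcal A(t)\varphi_J\le M_J$ on $J\times\mathbb R^d$. Then for every $f\in C_b(\mathbb R^d)$ the function $(t,s,x)\mapsto(G(t,s)f)(x)$ is continuous on $\Lambda\times\mathbb R^d$.
   Context: Let $d\ge1$, $\alpha\in(0,1)$, $I\subseteq\mathbb R$ either $\mathbb R$ or a right half-line, $\Lambda=\{(t,s)\in I\times I:t\ge s\}$. For $t\in I$, $(\mathcal A(t)\psi)(x)=\sum_{i,j}q_{ij}(t,x)D_{ij}\psi(x)+\sum_ib_i(t,x)D_i\psi(x)-c(t,x)\psi(x)$, with: $q_{ij},b_i,c\in C^{\alpha/2,\alpha}_{\rm loc}(I\times\mathbb R^d)$; $\inf c>-\infty$; $Q=(q_{ij})$ symmetric with $\langle Q(t,x)\xi,\xi\rangle\ge\eta(t,x)|\xi|^2$, $\inf\eta>0$; for every bounded interval $J\subset I$ there are positive $\phi_J\in C^2(\mathbb R^d)$ with $\phi_J\to+\infty$ at infinity and $\lambda_J$ with $\mathcal A(t)\phi_J\le\lambda_J\phi_J$ on $J\times\mathbb R^d$. $\mathcal A_{-c}(t)=\mathcal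 A(t)+c(t,\cdot)$. $G(t,s)$ is the evolution operator on $C_b(\mathbb R^d)$: $G(t,s)f=u_f(t,\cdot)$ for $t>s$, $u_f$ the unique solution (bounded on strips, in $C([s,\infty)\times\mathbb R^d)\cap C^{1+\alpha/2,2+\alpha}_{\rm loc}((s,\infty)\times\mathbb R^d)$) of $D_tu=\mathcal A(t)u$, $u(s)=f$; $G(t,t)=\mathrm{id}$. *)

(* Defs.v *)
From HB Require Import structures.
From mathcomp Require Import all_boot all_order all_algebra.
From mathcomp Require Import all_classical all_reals all_analysis.
Set Implicit Arguments. Unset Strict Implicit. Unset Printing Implicit Defensive.
Import Order.TTheory GRing.Theory Num.Theory.
Import numFieldNormedType.Exports.
Local Open Scope classical_set_scope.
Local Open Scope ring_scope.

Section Defs.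
Variables (R : realType) (d : nat).
Notation V := 'rV[R]_d.

Definition evec (i : 'I_d) : V := delta_mx 0 i.

Definition partial (i : 'I_d) (psi : V -> R) (x : V) : R := 'D_(evec i) psi x.

Definition C2 (psi : V -> R) : Prop :=
  continuous psi /\
  (forall i x, derivable psi x (evec i)) /\
  (forall i, continuous (partial i psi)) /\
  (forall i j x, derivable (partial j psi) x (evec i)) /\
  (forall i j, continuous (partial i (partial j psi))).

Definition to_infty (psi : V -> R) : Prop :=
  forall M : R, exists r : R, forall x : V, r < `|x| -> M < psi x.

Definition eucl2 (xi : V) : R := \sum_(i < d) (xi 0 i) ^+ 2.

Definition qform (Q : 'I_d -> 'I_d -> R) (xi : V) : R :=
  \sum_(i < d) \sum_(j < d) Q i j * xi 0 i * xi 0 j.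

Definition Aop0 (q : 'I_d -> 'I_d -> R -> V -> R) (b : 'I_d -> R -> V -> R)
  (t : R) (psi : V -> R) (x : V) : R :=
  \sum_(i < d) \sum_(j < d) q i j t x * partial i (partial j psi) x
  + \sum_(i < d) b i t x * partial i psi x.

Definition Aop (q : 'I_d -> 'I_d -> R -> V -> R) (b : 'I_d -> R -> V -> R)
  (c : R -> V -> R) (t : R) (psi : V -> R) (x : V) : R :=
  Aop0 q b t psi x - c t x * psi x.

(* g in C^{alpha/2,alpha}_loc(D x R^d), D an interval of R:
   parabolic Hoelder estimate on every compact [a,b] x closed ball with [a,b] in D *)
Definition holder_loc (alpha : R) (D : set R) (g : R -> V -> R) : Prop :=
  forall a b r : R, `[a, b] `<=` D ->
  exists C : R, forall t1 t2 : R, forall x1 x2 : V,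
    a <= t1 <= b -> a <= t2 <= b -> `|x1| <= r -> `|x2| <= r ->
    `|g t1 x1 - g t2 x2| <= C * (`|t1 - t2| `^ (alpha / 2) + `|x1 - x2| `^ alpha).

Definition bounded_interval (J : set R) : Prop :=
  is_interval J /\ exists a b : R, J `<=` `[a, b].

Definition dtime (u : R -> V -> R) (t : R) (x : V) : R :=
  'D_1 (fun tau : R => u tau x) t.

(* u is a solution of D_t u = A(t) u on (s,oo) x R^d, u(s) = f, in the class
   C([s,oo) x R^d) cap C^{1+alpha/2,2+alpha}_loc((s,oo) x R^d), bounded on strips *)
Definition is_solution (alpha : R) (q : 'I_d -> 'I_d -> R -> V -> R)
  (b : 'I_d -> R -> V -> R) (c : R -> V -> R) (s : R) (f : V -> R)
  (u : R -> V -> R) : Prop :=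
  ({within [set p : R * V | s <= p.1], continuous (fun p : R * V => u p.1 p.2)}) /\
      (forall T : R, exists M : R, forall t x, s <= t <= T -> `|u t x| <= M) /\
      (forall t x, s < t -> derivable (fun tau : R => u tau x) t 1
          /\ (forall i, derivable (u t) x (evec i))
          /\ (forall i j, derivable (partial j (u t)) x (evec i))) /\
      {within [set p : R * V | s < p.1], continuous (fun p : R * V => u p.1 p.2)}
        /\ (forall i, {within [set p : R * V | s < p.1],
                continuous (fun p : R * V => partial i (u p.1) p.2)}) /\
      holder_loc alpha `]s, +oo[ (dtime u)
        /\ (forall i j, holder_loc alpha `]s, +oo[
                          (fun t x => partial i (partial j (u t)) x)) /\
      (forall t x, s < t -> dtime u t x = Aop q b c t (u t) x) /\
      (forall x, u s x = f x).

End Defs.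

(* Main.v *)
(** For t > s0 the difference of the solutions started at s and at s0 solves the
    homogeneous equation after time max s s0.  Comparison with
    e^(k t) (e0 + e1 phi), phi a Lyapunov function, shows that it is small on
    compact sets as soon as its initial value is bounded and small on a large
    ball.  That initial value is controlled by the behaviour at the diagonal
    t = s, where the barriers eps + C |x - x0|^2 + N (t - s) on a small cylinder
    give |U s t x - f x0| small uniformly in s.  Both comparisons rest on the
    weak maximum principle on cylinders, applied to the minimum of e^(-mu t) y;
    there the Hessian is positive semidefinite, and its trace against the
    positive semidefinite diffusion matrix is nonnegative. *)

Require Import Defs.
From HB Require Import structures.
From mathcomp Require Import all_boot all_order all_algebra.
From mathcomp Require Import all_classical all_reals all_analysis.
From mathcomp Require Import ring lra.
Import Order.TTheory GRing.Theory Num.Theory.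
Import numFieldNormedType.Exports.
Local Open Scope classical_set_scope.
Local Open Scope ring_scope.

(** Solutions started at [s] and at [s0] share no initial time, so they can be compared only from
    [max s s0] on. There both are near [f], but only locally in space; far away their difference is
    merely bounded. This is the reason for the term [e1 * phi]: since [phi] is unbounded, even a
    tiny multiple of it dominates the difference outside a large ball, while on a fixed compact set
    this multiple stays small.

    The other obstacle is uniformity in the starting time: the strip bound and the continuity at the
    initial time contained in [is_solution] come for each [s] separately. They are replaced by one
    bound [K1] for all solutions on [[a, T]], and by barriers whose constants depend only on [K1],
    the modulus of continuity of [f] at one point and bounds for the coefficients on one
    cylinder. *)

(** * Linear algebra: positive semidefinite forms and traces *)

Lemma qform_shift (R : realType) (n : nat) (Q : 'I_n -> 'I_n -> R) (p : 'I_n)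
    (a : R) (xi : 'rV[R]_n) : (forall i j, Q i j = Q j i) ->
  qform Q (xi + a *: evec R p) =
  qform Q xi + 2 * a * (\sum_(j < n) Q p j * xi 0 j) + a ^+ 2 * Q p p.
Proof.
move=> symQ.
have sumdelta (F : 'I_n -> R) : \sum_(j < n) F j * (j == p)%:R = F p.
  rewrite (bigD1 p) //= eqxx mulr1 big1 ?addr0 // => j /negPf ->.
  by rewrite mulr0.
pose L := \sum_(j < n) Q p j * xi 0 j.
have row (i : 'I_n) : \sum_(j < n) Q i j * (xi + a *: evec R p) 0 i *
    (xi + a *: evec R p) 0 j =
    (\sum_(j < n) Q i j * xi 0 i * xi 0 j + a * (Q p i * xi 0 i))
    + (a * (\sum_(j < n) Q i j * xi 0 j) + a ^+ 2 * Q i p) * (i == p)%:R.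
  rewrite (eq_bigr (fun j => Q i j * xi 0 i * xi 0 j
      + (a * (i == p)%:R) * (Q i j * xi 0 j)
      + (a * Q i j * (xi 0 i + a * (i == p)%:R)) * (j == p)%:R)); last first.
    by move=> j _; rewrite !mxE eqxx /=; ring.
  rewrite !big_split /= sumdelta -mulr_sumr (symQ i p); ring.
rewrite /qform (eq_bigr _ (fun i _ => row i)) !big_split /= sumdelta -mulr_sumr.
by rewrite -/L; ring.
Qed.

Lemma psd_trace_ge0 (R : realType) (n : nat) (Q H : 'I_n -> 'I_n -> R) :
  (forall i j, Q i j = Q j i) -> (forall xi, 0 <= qform Q xi) ->
  (forall xi, 0 <= qform H xi) ->
  0 <= \sum_(i < n) \sum_(j < n) Q i j * H i j.
Proof.
move=> symQ psdQ psdH.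
(* Schur complements: the entries of Q are eliminated one pivot at a time,
   each pivot contributing a nonnegative multiple of a value of qform H. *)
suff elim_pivots (k : nat) : forall Q : 'I_n -> 'I_n -> R,
    (forall i j, Q i j = Q j i) -> (forall xi, 0 <= qform Q xi) ->
    (forall i j : 'I_n, (k <= i)%N -> Q i j = 0) ->
    0 <= \sum_(i < n) \sum_(j < n) Q i j * H i j.
  by apply: (elim_pivots n) => // i j; rewrite leqNgt ltn_ord.
elim: k => [|k IH] {symQ psdQ}Q symQ psdQ suppQ.
  rewrite big1 // => i _; rewrite big1 // => j _.
  by rewrite suppQ // mul0r.
have [nk|kn] := leqP n k.
  by apply: IH => // i j ki; move: (ltn_ord i); rewrite ltnNge (leq_trans nk ki).
pose p := Ordinal kn.
have kE (i : 'I_n) : (k <= i)%N -> i = p \/ (k < i)%N.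
  by rewrite leq_eqVlt => /orP[/eqP ki|]; [left; apply: val_inj|right].
have Qpp_ge0 : 0 <= Q p p.
  have := psdQ (0 + 1 *: evec R p); rewrite qform_shift // expr1n mul1r.
  rewrite big1 ?mulr0 ?addr0; last by move=> j _; rewrite mxE mulr0.
  suff -> : qform Q 0 = 0 by rewrite add0r.
  rewrite /qform big1 // => i _; rewrite big1 // => j _.
  by rewrite !mxE mulr0.
have [Qpp0|Qpp_neq0] := eqVneq (Q p p) 0.
  apply: IH => // i j /kE[->|ki]; last exact: suppQ.
  apply/eqP/negPn/negP => Qpj.
  (* With [Q p p] zero, the form is affine in [a] on the line through [evec R j] in direction
     [evec R p], with slope [2 * Q p j]; this [a] gives it the value -1. *)
  pose a := - (qform Q (evec R j) + 1) / (2 * Q p j).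
  have := psdQ (evec R j + a *: evec R p); rewrite qform_shift // Qpp0 mulr0.
  rewrite addr0 (bigD1 j) //= big1 ?addr0; last first.
    by move=> l /negPf lj; rewrite !mxE lj andbF mulr0.
  rewrite !mxE !eqxx /= mulr1.
  suff -> : 2 * a * Q p j = - (qform Q (evec R j) + 1).
    by rewrite opprD addNKr lerNr oppr0 ler10.
  by rewrite /a; field; rewrite Qpj.
pose Q' i j := Q i j - Q p i * Q p j / Q p p.
have trE : \sum_(i < n) \sum_(j < n) Q i j * H i j =
    \sum_(i < n) \sum_(j < n) Q' i j * H i j
    + (Q p p)^-1 * qform H (\row_j Q p j).
  rewrite /qform mulr_sumr -big_split /=; apply: eq_bigr => i _.
  rewrite mulr_sumr -big_split /=; apply: eq_bigr => j _.
  by rewrite !mxE /Q'; field.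
rewrite trE addr_ge0 //; last by rewrite mulr_ge0 // invr_ge0.
apply: IH.
- by move=> i j; rewrite /Q' (symQ i j) (mulrC (Q p i)).
- move=> xi; pose L := \sum_(j < n) Q p j * xi 0 j.
  (* The Schur complement at [xi] is the minimum over [a] of [qform Q (xi + a *: evec R p)],
     attained at [a = - L / Q p p]; hence it inherits nonnegativity. *)
  have -> : qform Q' xi = qform Q (xi + (- (L / Q p p)) *: evec R p).
    rewrite qform_shift // -/L.
    have -> : qform Q' xi = qform Q xi - (Q p p)^-1 * (L * L).
      rewrite /qform /L mulr_suml mulr_sumr -sumrB; apply: eq_bigr => i _.
      rewrite !mulr_sumr -sumrB; apply: eq_bigr => j _.
      by rewrite /Q'; field.
    by field.
  exact: psdQ.
- move=> i j /kE[->|ki]; rewrite /Q'; first by field.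
  by rewrite (symQ p i) !(suppQ i) // !mul0r subrr.
Qed.

(** * Directional derivatives and derivative tests at a minimum *)

Lemma is_derive_line (R : realType) (V : normedModType R) (f : V -> R)
    (x v : V) (t df : R) :
  is_derive (x + t *: v) v f df ->
  is_derive t 1 (fun h : R => f (x + h *: v)) df.
Proof.
move=> [fd <-].
pose g1 := fun h : R => h^-1 *: (f (h *: v + (x + t *: v)) - f (x + t *: v)).
pose g2 := fun h : R =>
  h^-1 *: (f (x + (h *: (1 : R) + t) *: v) - f (x + t *: v)).
have E : g1 = g2.
  by apply/funext => h; rewrite /g1 /g2 [_%:A]mulr1 scalerDl addrCA.
split; rewrite /derivable /derive /= -/g2 -E //.
Qed.

Lemma is_derive_scale_dir (R : realType) (V : normedModType R) (f : V -> R)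
    (x v : V) (a df : R) :
  is_derive x v f df -> is_derive x (a *: v) f (a * df).
Proof.
move=> fd; have g_deriv : is_derive (a * 0) 1 (fun h : R => f (x + h *: v)) df.
  by apply: is_derive_line; rewrite mulr0 scale0r addr0.
have a_deriv : is_derive (0 : R) 1 ( *%R a) a.
  by apply: is_derive_eq; rewrite [_%:A]mulr1.
have [] := is_derive1_comp g_deriv a_deriv.
pose g1 := fun h : R => h^-1 *: (f (h *: (a *: v) + x) - f x).
pose g2 := fun h : R =>
  h^-1 *: (f (x + (a * (h *: (1 : R) + 0)) *: v) - f (x + (a * 0) *: v)).
have E : g2 = g1.
  apply/funext => h; rewrite /g1 /g2 [_%:A]mulr1 mulr0 scale0r !addr0 scalerA.
  by rewrite (mulrC a) (addrC x).
rewrite /derivable /derive /= -/g2 E => gd gE; split => //.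
by rewrite /derive -/g1 gE mulrC.
Qed.

Lemma MVT_line (R : realType) (V : normedModType R) (f : V -> R) (x v : V) :
  (forall y, derivable f y v) ->
  exists2 t : R, 0 <= t <= 1 & f (x + v) - f x = 'D_v f (x + t *: v).
Proof.
move=> fd; have dline (t : R) := is_derive_line _ _ f _ _ _ _
  (derivableP (fd (x + t *: v))).
have := @MVT_segment R (fun h : R => f (x + h *: v))
    (fun h : R => 'D_v f (x + h *: v)) 0 1 ler01 (fun t _ => dline t).
case=> [|t].
  by apply: derivable_within_continuous => t _; case: (dline t).
rewrite in_itv /= => t01 E; exists t => //.
by move: E; rewrite scale1r scale0r addr0 subr0 mulr1.
Qed.

(** Directional derivatives need not be additive in the direction. Here the step along [h *: w]
    starts from the moving point [h *: v + x]; the mean value theorem turns it into a value of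
    ['D_w f] near [x], and continuity of ['D_w f] at [x] gives the limit. *)
Lemma is_derive_add_dir (R : realType) (V : normedModType R) (f : V -> R)
    (x v w : V) (df : R) :
  is_derive x v f df -> (forall y, derivable f y w) ->
  {for x, continuous ('D_w f)} -> is_derive x (v + w) f (df + 'D_w f x).
Proof.
move=> [fv <-] fw cw.
suff L : h^-1 *: (f (h *: (v + w) + x) - f x) @[h --> (0:R)^'] -->
    'D_v f x + 'D_w f x.
  by split; [apply/cvg_ex; eexists; exact: L|exact: cvg_lim L].
have -> : (fun h : R => h^-1 *: (f (h *: (v + w) + x) - f x)) =
    (fun h : R => h^-1 *: (f (h *: v + x) - f x)
       + h^-1 *: (f (h *: v + x + h *: w) - f (h *: v + x))).
  apply/funext => h; rewrite (scalerDr h v w) (addrAC (h *: v) (h *: w) x).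
  by rewrite /GRing.scale /=; ring.
apply: cvgD; first exact: fv.
apply/cvgrPdist_le => e e0.
have /cvgrPdist_le/(_ e e0)/nbhs_ballP[r /= r0 br] := cw.
(* Keeps the intermediate point of the mean value theorem within [r] of [x]; the summand 1 avoids a
   zero divisor when [v] and [w] vanish. *)
have cr : \forall h \near (0:R)^', `|h| * (`|v| + `|w| + 1) < r.
  near do rewrite -ltr_pdivlMr ?ltr_wpDl ?addr_ge0 //.
  by apply: dnbhs0_lt; rewrite divr_gt0 ?ltr_wpDl ?addr_ge0.
near=> h.
have h0 : h != 0 by near: h; exact: nbhs_dnbhs_neq.
have hr : `|h| * (`|v| + `|w| + 1) < r by near: h.
have fhw y : derivable f y (h *: w).
  by have [] := is_derive_scale_dir _ _ f _ _ h _ (derivableP (fw y)).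
have [t /andP[t0 t1] ->] := MVT_line _ _ f (h *: v + x) (h *: w) fhw.
have -> : 'D_(h *: w) f (h *: v + x + t *: (h *: w)) =
    h * 'D_w f (h *: v + x + t *: (h *: w)).
  by have [] := is_derive_scale_dir _ _ f _ _ h _ (derivableP (fw (h *: v + x + t *: (h *: w)))).
rewrite [_ *: _]mulKf //; apply: br.
rewrite -ball_normE /= addrAC opprD addrCA subrr addr0 normrN.
apply: le_lt_trans hr; rewrite scalerA (mulrC t) -scalerA -scalerDr normrZ.
rewrite ler_wpM2l // (le_trans (ler_normD _ _)) // normrZ (ger0_norm t0).
have := ler_wpM2r (normr_ge0 w) t1; lra.
Unshelve. all: by end_near. Qed.

(** [C2] speaks of partial derivatives only; adding the coordinate directions one at a time gives
    all directional derivatives. *)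
Lemma is_derive_partials (R : realType) (d : nat) (g : 'rV[R]_d -> R) :
  (forall i x, derivable g x (evec R i)) ->
  (forall i, continuous (partial i g)) ->
  forall x xi : 'rV[R]_d,
    is_derive x xi g (\sum_(i < d) xi 0 i * partial i g x).
Proof.
move=> gd gc x xi; rewrite {1}(row_sum_delta xi).
elim: (index_enum _) => [|i s IH]; first by rewrite !big_nil; exact: is_derive0.
rewrite !big_cons addrC [X in is_derive _ _ _ X]addrC.
have dscale y : is_derive y (xi 0 i *: evec R i) g (xi 0 i * partial i g y).
  exact/is_derive_scale_dir/derivableP.
have dE : 'D_(xi 0 i *: evec R i) g = (fun y => xi 0 i * partial i g y).
  by apply/funext => y; case: (dscale y).
rewrite -[xi 0 i * partial i g x]/((fun y => xi 0 i * partial i g y) x) -dE.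
apply: is_derive_add_dir => [y|].
  by case: (dscale y).
by rewrite dE; apply: continuousM; [exact: cst_continuous|exact: gc].
Qed.

(** If [h2] were negative, [h1] would be negative just to the right of 0, and the mean value theorem
    would push [h] below [h 0] there. *)
Lemma second_derivative_test (R : realType) (h h1 : R -> R) (h2 : R) :
  (forall t : R, is_derive t 1 h (h1 t)) -> is_derive (0 : R) 1 h1 h2 ->
  (\forall t \near (0 : R), h 0 <= h t) -> h1 0 = 0 /\ 0 <= h2.
Proof.
move=> hd h1d /nbhs_ballP[r /= r0 hmin].
have minr t : t \in `]- r, r[ -> h 0 <= h t.
  rewrite in_itv /= => tr; apply: hmin.
  by rewrite -ball_normE /= sub0r normrN ltr_norml.
have h10 : h1 0 = 0.
  have [_ E1] : is_derive (0 : R) 1 h 0.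
    apply: (@derive1_at_min _ h (- r) r 0) => //.
    - by rewrite ge0_cp // ltW.
    - by rewrite in_itv /= oppr_lt0 r0.
  by have [_ E2] := hd 0; rewrite -E2 E1.
split=> //; rewrite leNgt; apply/negP => h20.
have [h1dv h1E] := h1d.
have L : t^-1 *: (h1 (t *: (1 : R) + 0) - h1 0) @[t --> (0:R)^'] --> h2.
  by rewrite -h1E; exact: h1dv.
have e0 : 0 < - h2 by rewrite oppr_gt0.
move: L => /cvgrPdist_lt/(_ _ e0).
rewrite /dnbhs near_withinE => /nbhs_ballP[e /= e_gt0 he].
have neg t : 0 < t < e -> h1 t < 0.
  move=> /andP[t0 te]; have := he t; rewrite -ball_normE /= sub0r normrN gtr0_norm //.
  rewrite gt_eqF // => /(_ te isT); rewrite h10 subr0 addr0 [_%:A]mulr1.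
  rewrite ltr_norml opprK => /andP[+ _].
  by rewrite -subr_lt0 opprB addrCA subrr addr0 pmulr_rlt0 // invr_gt0.
pose t := Num.min e r / 2.
have m0 : 0 < Num.min e r by rewrite lt_min e_gt0.
have t0 : 0 < t by rewrite divr_gt0.
have te : t < e.
  by apply: lt_le_trans (_ : Num.min e r <= e); rewrite ?ge_min ?lexx // /t; lra.
have tr : t < r.
  by apply: lt_le_trans (_ : Num.min e r <= r); rewrite ?ge_min ?lexx ?orbT // /t; lra.
have [|c] := @MVT R h h1 0 t t0 (fun s _ => hd s).
  by apply: derivable_within_continuous => s _; case: (hd s).
rewrite in_itv /= subr0 => /andP[c0 ct] E.
have : h 0 <= h t by apply: minr; rewrite in_itv /= tr andbT; lra.
have : h1 c * t < 0 by rewrite pmulr_llt0 // neg // c0 (lt_trans ct te).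
by rewrite -E subr_lt0 leNgt => ->.
Qed.

(** The one-variable test is applied to the restriction of [g] to every line through [x]. *)
Lemma C2_local_min (R : realType) (d : nat) (g : 'rV[R]_d -> R) (x : 'rV[R]_d) :
  C2 g -> (\forall y \near x, g x <= g y) ->
  (forall i, partial i g x = 0) /\
  (forall xi, 0 <= qform (fun i j => partial i (partial j g) x) xi).
Proof.
move=> [gc [gd [pc [pd p2c]]]] gmin.
have test (xi : 'rV[R]_d) : \sum_(i < d) xi 0 i * partial i g x = 0 /\
    0 <= qform (fun i j => partial i (partial j g) x) xi.
  have dg (t : R) := is_derive_line _ _ g x xi t _
    (is_derive_partials _ _ g gd pc (x + t *: xi) xi).
  have dG : is_derive (0 : R) 1
      (fun t : R => \sum_(j < d) xi 0 j * partial j g (x + t *: xi))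
      (\sum_(j < d) xi 0 j *
         (\sum_(i < d) xi 0 i * partial i (partial j g) x)).
    pose F j := (fun t : R => xi 0 j * partial j g (x + t *: xi)).
    rewrite [f in is_derive _ _ f _](_ : _ = \sum_(j < d) F j); last first.
      by apply/funext => t; rewrite fct_sumE.
    apply: is_derive_sum => j.
    have dj : is_derive (0 : R) 1 (fun t : R => partial j g (x + t *: xi))
        (\sum_(i < d) xi 0 i * partial i (partial j g) x).
      have := is_derive_partials _ _ (partial j g) (pd^~ j) (p2c^~ j) x xi.
      by move=> ?; apply: is_derive_line; rewrite scale0r addr0.
    exact: (@is_deriveZ _ _ _ _ (xi 0 j) _ _ _ dj).
  have [|E0 H] := second_derivative_test _ _ _ _ dg dG.
    rewrite scale0r addr0.
    suff : x + t *: xi @[t --> (0:R)] --> x by move/(_ _ gmin).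
    rewrite -{2}[x]addr0 -[in X in _ --> X](scale0r xi).
    by apply: cvgD; [exact: cvg_cst|apply: cvgZl; exact: cvg_id].
  split; first by move: E0; rewrite scale0r addr0.
  rewrite /qform exchange_big /=; move: H; congr (_ <= _).
  apply: eq_bigr => j _; rewrite mulr_sumr; apply: eq_bigr => i _.
  by ring.
split=> [i|xi]; last by case: (test xi).
have [+ _] := test (evec R i); rewrite (bigD1 i) //= big1 ?addr0.
  by rewrite mxE !eqxx mul1r.
by move=> j /negPf ji; rewrite mxE ji andbF mul0r.
Qed.

(** A minimum over a time interval may sit at its final time, where only earlier times can be
    compared; left difference quotients alone give the sign. *)
Lemma derive_left_min (R : realType) (h : R -> R) (s t dh : R) :
  is_derive t 1 h dh -> s < t -> (forall u, s <= u <= t -> h t <= h u) ->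
  dh <= 0.
Proof.
move=> [hd hE] st hmin; rewrite leNgt; apply/negP => dh0.
have L : u^-1 *: (h (u *: (1 : R) + t) - h t) @[u --> (0:R)^'] --> dh.
  by rewrite -hE; exact: hd.
move: L => /cvgrPdist_lt/(_ _ dh0).
rewrite /dnbhs near_withinE => /nbhs_ballP[e /= e0 he].
pose u := Num.min e (t - s) / 2.
have m0 : 0 < Num.min e (t - s) by rewrite lt_min e0 subr_gt0.
have u0 : 0 < u by rewrite divr_gt0.
have ue : u < e.
  by apply: lt_le_trans (_ : Num.min e (t - s) <= e); rewrite ?ge_min ?lexx // /u; lra.
have ut : u < t - s.
  by apply: lt_le_trans (_ : Num.min e (t - s) <= t - s);
    rewrite ?ge_min ?lexx ?orbT // /u; lra.
have := he (- u); rewrite -ball_normE /= sub0r opprK gtr0_norm // => /(_ ue).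
rewrite oppr_eq0 gt_eqF // => /(_ isT); rewrite [_%:A]mulr1 invrN.
have /hmin hu : s <= - u + t <= t by apply/andP; split; lra.
have : 0 <= u^-1 * (h (- u + t) - h t) by rewrite mulr_ge0 ?subr_ge0 // invr_ge0 ltW.
set X := u^-1 * _ => X0; have -> : - u^-1 *: (h (- u + t) - h t) = - X.
  by rewrite scaleNr.
by rewrite opprK gtr0_norm; lra.
Qed.

Lemma closed_ball_compact_rV (R : realType) (d : nat) (x0 : 'rV[R]_d) (r : R) :
  compact [set x : 'rV[R]_d | `|x - x0| <= r].
Proof.
apply: bounded_closed_compact.
  exists (r + `|x0|); split; first exact: num_real.
  move=> M rM x /= xr; apply/ltW/le_lt_trans/rM.
  by rewrite -[x in `|x|](subrK x0) (le_trans (ler_normD _ _)) // lerD2r.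
have dist_continuous : continuous (fun x : 'rV[R]_d => `|x - x0|).
  move=> x; apply: (@cvg_norm _ _ _ (nbhs x)).
  by apply: cvgB; [exact: cvg_id|exact: cvg_cst].
have /continuous_closedP cl := dist_continuous.
exact: cl _ (@closed_le _ r).
Qed.

(** * The parabolic operator and its linearity *)

Section ParabolicOperator.
Variables (R : realType) (d : nat).
Notation V := 'rV[R]_d.
Variables (q : 'I_d -> 'I_d -> R -> V -> R) (b : 'I_d -> R -> V -> R).
Variable c : R -> V -> R.

(** Differentiability is asked for after time [s] only, because the initial datum is merely
    continuous. *)
Definition C12 (s : R) (y : R -> V -> R) : Prop :=
  [/\ {within [set p : R * V | s <= p.1], continuous (fun p : R * V => y p.1 p.2)},
      (forall t, s < t -> C2 (y t)) &
      (forall t x, s < t -> derivable (fun tau : R => y tau x) t 1)].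

(** The residual of the equation: zero on solutions, nonnegative on supersolutions. *)
Definition parab (y : R -> V -> R) (t : R) (x : V) : R :=
  dtime y t x - Aop q b c t (y t) x.

Lemma partial_lin (i : 'I_d) (a : R) (f g : V -> R) :
  (forall x, derivable f x (evec R i)) -> (forall x, derivable g x (evec R i)) ->
  partial i (fun x => a * f x + g x) =
    (fun x => a * partial i f x + partial i g x).
Proof.
move=> fd gd; apply/funext => x; rewrite /partial.
have -> : (fun x => a * f x + g x) = (a \*: f) + g by [].
by rewrite deriveD ?deriveZ //; exact: derivableZ.
Qed.

Lemma derivable_lin (W : normedModType R) (a : R) (f g : W -> R) (x v : W) :
  derivable f x v -> derivable g x v -> derivable (fun x => a * f x + g x) x v.
Proof.
by move=> fd gd; apply: (@derivableD _ _ _ (a \*: f) g) => //; exact: derivableZ.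
Qed.

Lemma continuous_lin (W : topologicalType) (a : R) (f g : W -> R) :
  continuous f -> continuous g -> continuous (fun x => a * f x + g x).
Proof.
move=> fc gc x; apply: cvgD; last exact: gc.
by apply: cvgMl_tmp; exact: fc.
Qed.

Lemma C2_lin (a : R) (f g : V -> R) :
  C2 f -> C2 g -> C2 (fun x => a * f x + g x).
Proof.
move=> [fc [fd [pfc [pfd p2fc]]]] [gc [gd [pgc [pgd p2gc]]]].
have pE i := partial_lin i a f g (fd i) (gd i).
split; first exact: continuous_lin.
split; first by move=> i x; exact: derivable_lin.
split; first by move=> i; rewrite pE; exact: continuous_lin.
split=> i j; first by move=> x; rewrite pE; exact: derivable_lin.
by rewrite pE partial_lin //; exact: continuous_lin.
Qed.

Lemma Aop_lin (t a : R) (f g : V -> R) (x : V) : C2 f -> C2 g ->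
  Aop q b c t (fun x => a * f x + g x) x =
    a * Aop q b c t f x + Aop q b c t g x.
Proof.
move=> [_ [fd [_ [pfd _]]]] [_ [gd [_ [pgd _]]]].
have pE i := partial_lin i a f g (fd i) (gd i).
have combine (A B A1 B1 A2 B2 C F G : R) : A = a * A1 + A2 -> B = a * B1 + B2 ->
    A + B - C * (a * F + G) = a * (A1 + B1 - C * F) + (A2 + B2 - C * G).
  by move=> -> ->; ring.
apply: combine.
- rewrite mulr_sumr -big_split /=; apply: eq_bigr => i _.
  rewrite mulr_sumr -big_split /=; apply: eq_bigr => j _.
  by rewrite pE partial_lin //; ring.
- rewrite mulr_sumr -big_split /=; apply: eq_bigr => i _.
  by rewrite pE; ring.
Qed.

Lemma C12_lin (s a : R) (y z : R -> V -> R) :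
  C12 s y -> C12 s z -> C12 s (fun t x => a * y t x + z t x).
Proof.
move=> [yc y2 yd] [zc z2 zd]; split.
- exact: (@continuous_lin (subspace [set p : R * V | s <= p.1]) a _ _ yc zc).
- by move=> t st; exact: C2_lin (y2 _ st) (z2 _ st).
- by move=> t x st; exact: derivable_lin (yd t x st) (zd t x st).
Qed.

Lemma parab_lin (s a : R) (y z : R -> V -> R) (t : R) (x : V) :
  C12 s y -> C12 s z -> s < t ->
  parab (fun t x => a * y t x + z t x) t x = a * parab y t x + parab z t x.
Proof.
move=> [_ y2 yd] [_ z2 zd] st; rewrite /parab Aop_lin; [|exact: y2|exact: z2].
have -> : dtime (fun t x => a * y t x + z t x) t x = a * dtime y t x + dtime z t x.
  have dy := derivableP (yd t x st); have dz := derivableP (zd t x st).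
  by have [_ E] := is_deriveD (is_deriveZ a dy) dz; exact: E.
by ring.
Qed.

Lemma C12_le (s s' : R) (y : R -> V -> R) : s <= s' -> C12 s y -> C12 s' y.
Proof.
move=> ss' [yc y2 yd]; split.
- by apply: continuous_subspaceW yc => p /=; exact: le_trans.
- by move=> t s't; apply: y2; exact: le_lt_trans s't.
- by move=> t x s't; apply: yd; exact: le_lt_trans s't.
Qed.

Lemma C2_cst (k : R) : C2 (fun _ : V => k).
Proof.
have pE i : partial i (fun _ : V => k) = (fun _ => 0).
  by apply/funext => x; rewrite /partial -[fun _ => k]/(cst k) derive_cst.
have pE0 i : partial i (fun _ : V => 0 : R) = (fun _ => 0).
  by apply/funext => x; rewrite /partial -[fun _ => 0]/(cst 0) derive_cst.
do ?split.
- exact: cst_continuous.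
- by move=> i x; exact: derivable_cst.
- by move=> i; rewrite pE; exact: cst_continuous.
- by move=> i j x; rewrite pE; exact: derivable_cst.
- by move=> i j; rewrite pE pE0; exact: cst_continuous.
Qed.

(** All barriers below are combinations of such separated functions, the time factor being an
    exponential, a constant or [t - s]. *)
Lemma C12_prod (s : R) (e de : R -> R) (g : V -> R) :
  (forall t : R, is_derive t 1 e (de t)) -> C2 g ->
  C12 s (fun t x => e t * g x) /\
  (forall t x, parab (fun t x => e t * g x) t x =
     de t * g x - e t * Aop q b c t g x).
Proof.
move=> ed g2.
have E (t : R) : (fun x : V => e t * g x) = (fun x => e t * g x + 0).
  by apply/funext => x; rewrite addr0.
have dE (x : V) (t : R) : is_derive t 1 (fun tau => e tau * g x) (de t * g x).
  have -> : (fun tau => e tau * g x) = g x \*: e.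
    by apply/funext => tau /=; rewrite mulrC.
  by rewrite mulrC; exact: is_deriveZ.
have A0 (t : R) (x : V) : Aop q b c t (fun _ => 0) x = 0.
  have := Aop_lin t 1 (fun _ => 0) (fun _ => 0) x (C2_cst 0) (C2_cst 0).
  under eq_fun do rewrite mulr0 addr0.
  by lra.
split; first split.
- apply: continuous_subspaceT => p /=.
  have ec : {for p.1, continuous e}.
    by apply: differentiable_continuous; apply/derivable1_diffP; case: (ed p.1).
  apply: (@cvgM R).
    by apply: continuous_comp ec; exact: cvg_fst.
  by apply: continuous_comp; [exact: cvg_snd|case: g2 => gc _; exact: gc].
- by move=> t _; rewrite E; apply: C2_lin g2 (C2_cst 0).
- by move=> t x _; case: (dE x t).
- move=> t x; congr (_ - _); first by have [_ dtE] := dE x t; exact: dtE.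
  have := Aop_lin t (e t) g (fun _ => 0) x g2 (C2_cst 0).
  by rewrite -(E t) A0 addr0.
Qed.

End ParabolicOperator.

Lemma is_derive_expR_affine (R : realType) (k s u : R) :
  is_derive u 1 (fun v : R => expR (k * (v - s))) (k * expR (k * (u - s))).
Proof.
have dsub : is_derive u 1 (fun v : R => v - s) 1.
  apply: is_derive_eq (is_deriveB (is_derive_id u 1) (is_derive_cst s u 1)) _.
  by rewrite subr0.
have dlin : is_derive u 1 (fun v : R => k * (v - s)) k.
  by apply: is_derive_eq (is_deriveZ k dsub) _; rewrite [_%:A]mulr1.
have := @is_derive1_comp _ _ (fun v : R => k * (v - s)) _ _ _
  (is_derive_expR (k * (u - s))) dlin.
by rewrite mulrC.
Qed.

(** * Weak maximum principles on cylinders and on the whole space *)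

Section MaximumPrinciple.
Variables (R : realType) (d : nat).
Notation V := 'rV[R]_d.
Variables (q : 'I_d -> 'I_d -> R -> V -> R) (b : 'I_d -> R -> V -> R).
Variables (c : R -> V -> R) (c0 : R) (s T : R).
Hypothesis q_sym : forall i j t x, s < t <= T -> q i j t x = q j i t x.
Hypothesis q_psd : forall t x xi, s < t <= T -> 0 <= qform (fun i j => q i j t x) xi.
Hypothesis c_ge : forall t x, s < t <= T -> c0 <= c t x.

Lemma max_principle_cylinder (x0 : V) (r : R) (y : R -> V -> R) :
  C12 R d s y ->
  (forall x, `|x - x0| <= r -> 0 <= y s x) ->
  (forall t x, s <= t <= T -> `|x - x0| = r -> 0 <= y t x) ->
  (forall t x, s < t <= T -> `|x - x0| < r -> 0 <= parab R d q b c y t x) ->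
  forall t x, s <= t <= T -> `|x - x0| <= r -> 0 <= y t x.
Proof.
move=> [yc y2 yd] y_init y_lat y_super t1 x1 t1sT x1r.
rewrite leNgt; apply/negP => y1_lt0.
(* Since [c0 <= c], this makes [mu + c] at least 1. At a negative minimum of [F] the time derivative
   gives [D_t y <= mu * y] and the space derivatives give [- c * y <= A y]; a supersolution would
   thus satisfy [0 <= (mu + c) * y], which is impossible. *)
pose mu := 1 - c0.
pose F (p : R * V) := expR (- mu * p.1) * y p.1 p.2.
pose K := [set t | s <= t <= T] `*` [set x : V | `|x - x0| <= r].
have K_compact : compact K.
  apply: compact_setX; last exact: closed_ball_compact_rV.
  by have := @segment_compact _ s T; rewrite set_itvcc.
have F_continuous : {within K, continuous F}.
  have sub : K `<=` [set p : R * V | s <= p.1] by move=> p [/= /andP[]].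
  move=> p; apply: (@cvgM R); last exact: (continuous_subspaceW sub yc).
  apply: (@continuous_subspaceT _ _ K (fun p : R * V => expR (- mu * p.1))).
  move=> {}p; apply: continuous_comp; last exact: continuous_expR.
  by apply: cvgMl_tmp; exact: cvg_fst.
have [[t x]] := compact_EVT_min (ex_intro K (t1, x1) (conj t1sT x1r))
  K_compact F_continuous.
rewrite inE => -[/= tsT xr] Fmin.
have {}Fmin u z : s <= u <= T -> `|z - x0| <= r -> F (t, x) <= F (u, z).
  by move=> us zr; apply: Fmin; rewrite inE.
have y_lt0 : y t x < 0.
  rewrite -(pmulr_rlt0 _ (expR_gt0 (- mu * t))).
  by apply: le_lt_trans (Fmin _ _ t1sT x1r) _; rewrite pmulr_rlt0 ?expR_gt0.
have st : s < t <= T.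
  case/andP: tsT => + ->; rewrite andbT le_eqVlt => /orP[/eqP ts|//].
  by move: y_lt0; rewrite -ts ltNge y_init.
have xr' : `|x - x0| < r.
  move: xr; rewrite le_eqVlt => /orP[/eqP xr|//].
  by move: y_lt0; rewrite ltNge y_lat.
have [p0 Hpsd] : (forall i, partial i (y t) x = 0) /\
    (forall xi, 0 <= qform (fun i j => partial i (partial j (y t)) x) xi).
  apply: C2_local_min; first by apply: y2; case/andP: st.
  apply/nbhs_ballP; exists (r - `|x - x0|); first by rewrite /= subr_gt0.
  move=> z; rewrite -ball_normE /= => xz.
  have := Fmin t z tsT; rewrite /F /= ler_pM2l ?expR_gt0 //; apply.
  have -> : z - x0 = (z - x) + (x - x0) by rewrite addrA subrK.
  by rewrite (le_trans (ler_normD _ _)) // distrC -lerBrDr ltW.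
have A_ge : - (c t x * y t x) <= Aop q b c t (y t) x.
  rewrite /Aop /Aop0 [X in _ + X - _]big1; last first.
    by move=> i _; rewrite p0 mulr0.
  rewrite addr0 lerDr; apply: psd_trace_ge0 Hpsd => [i j|xi].
    exact: q_sym.
  exact: q_psd.
have dt_le : dtime y t x - mu * y t x <= 0.
  have dF : is_derive t 1 (fun u => F (u, x))
      (expR (- mu * t) * (dtime y t x - mu * y t x)).
    have dexp : is_derive t 1 (fun u : R => expR (- mu * u)) (- mu * expR (- mu * t)).
      have := is_derive_expR_affine R (- mu) 0 t; rewrite subr0.
      by under eq_fun do rewrite subr0.
    have := is_deriveM dexp (derivableP (yd t x _)).
    case/andP: (st) => st' _ /(_ st') dM; apply: is_derive_eq dM _.
    by rewrite /dtime /GRing.scale /=; ring.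
  have : expR (- mu * t) * (dtime y t x - mu * y t x) <= 0.
    apply: (derive_left_min _ _ s t _ dF); first by case/andP: st.
    move=> u /andP[su ut]; apply: Fmin => //.
    by rewrite su (le_trans ut) //; case/andP: st.
  by rewrite pmulr_rle0 // expR_gt0.
have := y_super t x st xr'; rewrite /parab => sup.
have cge := c_ge t x st.
have : (mu + c t x) * y t x < 0 by rewrite pmulr_rlt0 // /mu; lra.
by lra.
Qed.

(** The whole space has no lateral boundary. Adding [a * (e t * phi x)] creates one: since [z] is
    bounded below by [- B], the sum is nonnegative on a large sphere. The penalty at the given point
    is arbitrarily small. *)
Lemma max_principle_Lyapunov (phi : V -> R) (lam B : R) (z : R -> V -> R) :
  C2 phi -> (forall x, 0 < phi x) -> to_infty phi ->
  (forall t x, s < t <= T -> Aop q b c t phi x <= lam * phi x) ->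
  C12 R d s z -> (forall x, 0 <= z s x) ->
  (forall t x, s <= t <= T -> - B <= z t x) ->
  (forall t x, s < t <= T -> 0 <= parab R d q b c z t x) ->
  forall t x, s <= t <= T -> 0 <= z t x.
Proof.
move=> phi2 phi_gt0 phi_infty phi_lam z12 z_init z_bound z_super t1 x1 t1sT.
(* With [|lam|] in place of [lam] the weight [e] is at least 1, so the penalty does not decay in
   time, and [e t * phi x] is still a supersolution. *)
pose k := `|lam|.
pose e (u : R) := expR (k * (u - s)).
have dexp (u : R) : is_derive u 1 e (k * e u).
  exact: is_derive_expR_affine.
have [ephi12 ephiE] := C12_prod R d q b c s e _ phi dexp phi2.
have e_ge1 u : s <= u -> 1 <= e u.
  by move=> su; rewrite -expR0 ler_expR mulr_ge0 ?subr_ge0 /k.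
suff penalised eps : 0 < eps -> - eps <= z t1 x1.
  rewrite leNgt; apply/negP => z_lt0.
  by have := penalised (- z t1 x1 / 2); lra.
move=> eps0; pose M := e t1 * phi x1.
have M0 : 0 < M by rewrite mulr_gt0 ?phi_gt0 ?expR_gt0.
(* The penalty at [(t1, x1)] is then exactly [eps]. *)
pose a := eps / M.
have a0 : 0 < a by rewrite divr_gt0.
have [rho rhoP] := phi_infty (B / a).
pose r := Num.max (rho + 1) `|x1|.
have big_ge0 : forall t x, s <= t <= T -> `|x| = r -> 0 <= a * (e t * phi x) + z t x.
  move=> t x tsT xr; have := z_bound t x tsT.
  suff : B <= a * (e t * phi x) by lra.
  have : B / a < phi x by apply: rhoP; rewrite xr lt_max ltrDl ltr01.
  rewrite ltr_pdivrMr // => /ltW Bphi; apply: le_trans Bphi _.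
  rewrite mulrC ler_wpM2l //; first exact: ltW.
  by rewrite ler_peMl ?e_ge1 //; [exact: ltW|case/andP: tsT].
have penalised_ge0 : 0 <= a * (e t1 * phi x1) + z t1 x1.
  apply: (max_principle_cylinder 0 r (fun t x => a * (e t * phi x) + z t x)).
  - exact: C12_lin.
  - move=> x _; apply: addr_ge0 => //; apply: mulr_ge0; first exact: ltW.
    by apply: mulr_ge0; [exact: expR_ge0|exact: ltW].
  - by move=> t x tsT; rewrite subr0; exact: big_ge0.
  - move=> t x st _; rewrite (parab_lin R d q b c s) //; last by case/andP: st.
    rewrite addr_ge0 ?z_super // mulr_ge0 ?(ltW a0) // ephiE.
    have := phi_lam t x st; have : lam * phi x <= k * phi x.
      by rewrite ler_pM2r // ler_norm.
    move=> h1 h2; rewrite -mulrA mulrCA -mulrBr mulr_ge0 ?expR_ge0 //; lra.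
  - exact: t1sT.
  - by rewrite subr0 le_max lexx orbT.
by move: penalised_ge0; rewrite -/M /a divfK ?gt_eqF //; lra.
Qed.

End MaximumPrinciple.

(** * Local bounds for the coefficients and regularity of solutions *)

Section Coefficients.
Variables (R : realType) (d : nat).
Notation V := 'rV[R]_d.

(** The Hölder estimate is used on the degenerate time interval [[t, t]], where the time increment
    contributes zero. *)
Lemma holder_loc_slice_continuous (alpha : R) (D : set R) (g : R -> V -> R) (t : R) :
  0 < alpha -> holder_loc alpha D g -> D t -> continuous (g t).
Proof.
move=> alpha0 gh Dt x.
have [|C gC] := gh t t (`|x| + 1).
  by move=> u /=; rewrite in_itv /= -eq_le => /eqP <-.
apply/(@cvgrPdist_le _ _ _ (nbhs x)) => e e0; pose C' := `|C| + 1.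
have C'0 : 0 < C' by rewrite /C' ltr_wpDl.
pose r := (e / C') `^ alpha^-1.
have r0 : 0 < r by rewrite powR_gt0 // divr_gt0.
near=> z.
have xz : `|x - z| <= r.
  by near: z; apply: (@cvgr_dist_le _ _ _ (nbhs x)) => //; exact: cvg_id.
have xz1 : `|x - z| <= 1.
  by near: z; apply: (@cvgr_dist_le _ _ _ (nbhs x)) => //; exact: cvg_id.
have zr : `|z| <= `|x| + 1.
  rewrite -[z in `|z|](subrK x) addrC (le_trans (ler_normD _ _)) //.
  by rewrite lerD2l distrC.
have xr : `|x| <= `|x| + 1 by rewrite lerDl.
have tt : t <= t <= t by rewrite lexx.
apply: (le_trans (gC t t x z tt tt xr zr)).
rewrite subrr normr0 powR0 ?add0r; last by rewrite gt_eqF // divr_gt0.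
have p : `|x - z| `^ alpha <= e / C'.
  have -> : e / C' = r `^ alpha.
    by rewrite /r -powRrM mulVf ?gt_eqF // powRr1 // ltW // divr_gt0.
  by apply: ge0_ler_powR; rewrite ?nnegrE //; exact: ltW.
apply: (@le_trans _ _ (C' * (e / C'))); last by rewrite mulrC divfK ?gt_eqF.
apply: (@le_trans _ _ (C' * `|x - z| `^ alpha)).
  by rewrite ler_wpM2r ?powR_ge0 // /C'; have := ler_norm C; lra.
by rewrite ler_wpM2l // ltW.
Unshelve. all: by end_near. Qed.

Variables (a T r : R).

(** On an empty cylinder any [B] would do; its sign is recorded because such bounds enter the
    barrier constants as nonnegative numbers. *)
Definition cyl_bounded (g : R -> V -> R) : Prop :=
  exists2 B : R, 0 <= B & forall t x, a <= t <= T -> `|x| <= r -> `|g t x| <= B.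

Lemma cyl_boundedD (g h : R -> V -> R) :
  cyl_bounded g -> cyl_bounded h -> cyl_bounded (fun t x => g t x + h t x).
Proof.
move=> [B B0 gB] [C C0 hC]; exists (B + C); first exact: addr_ge0.
by move=> t x ta xr; rewrite (le_trans (ler_normD _ _)) // lerD ?gB ?hC.
Qed.

Lemma cyl_boundedM (g h : R -> V -> R) :
  cyl_bounded g -> cyl_bounded h -> cyl_bounded (fun t x => g t x * h t x).
Proof.
move=> [B B0 gB] [C C0 hC]; exists (B * C); first exact: mulr_ge0.
by move=> t x ta xr; rewrite normrM ler_pM ?gB ?hC.
Qed.

Lemma cyl_bounded_sum (n : nat) (g : 'I_n -> R -> V -> R) :
  (forall i, cyl_bounded (g i)) -> cyl_bounded (fun t x => \sum_(i < n) g i t x).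
Proof.
move=> gb; elim: (index_enum _) => [|i l IH].
  by exists 0 => // t x _ _; rewrite big_nil normr0.
have [B B0 H] := cyl_boundedD _ _ (gb i) IH.
by exists B => // t x ta xr; rewrite big_cons; exact: H.
Qed.

Lemma cyl_bounded_continuous (g : V -> R) :
  continuous g -> cyl_bounded (fun _ x => g x).
Proof.
move=> gc; have [r0|r_lt0] := leP 0 r; last first.
  exists 0 => // t x _ /(le_trans (normr_ge0 x)).
  by rewrite leNgt r_lt0.
have Kc := closed_ball_compact_rV R d 0 r.
have ngc : {within [set x : V | `|x - 0| <= r], continuous (fun x => `|g x|)}.
  by apply: continuous_subspaceT => x; apply: (@cvg_norm _ _ _ (nbhs x)); exact: gc.
have [|x xK gmax] := compact_EVT_max _ Kc ngc.
  by exists 0 => /=; rewrite subrr normr0.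
exists `|g x| => // t z _ zr; apply: gmax.
by rewrite inE /= subr0.
Qed.

Lemma cyl_bounded_holder (alpha : R) (D : set R) (g : R -> V -> R) :
  0 < alpha -> holder_loc alpha D g -> `[a, T] `<=` D -> cyl_bounded g.
Proof.
move=> alpha0 gh aTD; have [C gC] := gh a T r aTD.
exists (`|g a 0| + `|C| * (`|T - a| `^ (alpha / 2) + `|r| `^ alpha)).
  by rewrite addr_ge0 // mulr_ge0 // addr_ge0 // powR_ge0.
move=> t x /andP[at_ tT] xr.
have r0 : 0 <= r by exact: le_trans xr.
have aT : a <= T by exact: le_trans tT.
have := gC t a x 0; rewrite at_ tT lexx aT normr0 => /(_ isT isT xr r0) H.
rewrite -[g t x](subrK (g a 0)) (le_trans (ler_normD _ _)) // addrC lerD2l.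
apply: (le_trans H); apply: (@le_trans _ _ (`|C| * (`|t - a| `^ (alpha / 2) + `|x - 0| `^ alpha))).
  by rewrite ler_wpM2r ?ler_norm // addr_ge0 // powR_ge0.
rewrite ler_wpM2l // lerD //; apply: ge0_ler_powR; rewrite ?nnegrE //.
- by rewrite divr_ge0 // ltW.
- by rewrite !ger0_norm ?subr_ge0 // lerD2r.
- exact: ltW.
- by rewrite subr0 (ger0_norm r0).
Qed.

Variables (alpha : R) (D : set R).
Variables (q : 'I_d -> 'I_d -> R -> V -> R) (b : 'I_d -> R -> V -> R).
Variable c : R -> V -> R.

Lemma cyl_bounded_Aop (g : V -> R) : 0 < alpha -> `[a, T] `<=` D ->
  (forall i j, holder_loc alpha D (q i j)) ->
  (forall i, holder_loc alpha D (b i)) -> holder_loc alpha D c ->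
  C2 g -> cyl_bounded (fun t x => Aop q b c t g x).
Proof.
move=> alpha0 aTD qh bh ch [gc [_ [pc [_ p2c]]]].
have hb g' (g'h : holder_loc alpha D g') := cyl_bounded_holder _ _ _ alpha0 g'h aTD.
have [B B0 H] : cyl_bounded (fun t x => Aop0 q b t g x + c t x * (- g x)).
  apply: cyl_boundedD; last first.
    apply: cyl_boundedM; first exact: hb.
    by apply: cyl_bounded_continuous => x; apply: (@cvgN _ _ _ (nbhs x)); exact: gc.
  apply: cyl_boundedD.
    apply: cyl_bounded_sum => i; apply: cyl_bounded_sum => j.
    apply: cyl_boundedM; first exact: hb.
    exact: (cyl_bounded_continuous _ (p2c i j)).
  apply: cyl_bounded_sum => i; apply: cyl_boundedM; first exact: hb.
  exact: (cyl_bounded_continuous _ (pc i)).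
by exists B => // t x ta xr; have := H t x ta xr; rewrite mulrN.
Qed.

Lemma continuous_slice (A : set (R * V)) (F : R * V -> R) (t : R) :
  (forall x, A (t, x)) -> {within A, continuous F} ->
  continuous (fun x => F (t, x)).
Proof.
move=> At /subspace_continuousP Fc x.
have := Fc (t, x) (At x); apply: cvg_comp => P /= AP.
have : \forall p \near (t, x), A p -> P p by exact: AP.
have pairc : (t, z) @[z --> x] --> (t, x).
  apply: (@cvg_pair _ _ _ (nbhs x) (nbhs t) (nbhs x)); first exact: cvg_cst.
  exact: cvg_id.
move=> /pairc AP'; have : nbhs x (fun z => A (t, z) -> P (t, z)) by exact: AP'.
by apply: filterS => z; apply; exact: At.
Qed.

Lemma is_solution_C12 (s : R) (f : V -> R) (u : R -> V -> R) :
  0 < alpha -> is_solution alpha q b c s f u ->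
  C12 R d s u /\ (forall t x, s < t -> parab R d q b c u t x = 0).
Proof.
move=> alpha0 [uc [ub [ud [uc' [pc [dth [p2h [eq u0]]]]]]]]; split; last first.
  by move=> t x st; rewrite /parab eq // subrr.
split=> //; last by move=> t x /ud -/(_ x)[].
move=> t st; split.
  exact: (continuous_slice [set p : R * V | s < p.1] (fun p => u p.1 p.2) t).
split; first by move=> i x; case: (ud t x st) => _ [].
split.
  move=> i; exact: (continuous_slice [set p : R * V | s < p.1]
    (fun p => partial i (u p.1) p.2) t).
split; first by move=> i j x; case: (ud t x st) => _ [].
(* For the second partials [is_solution] offers a Hölder estimate, from which their continuity in
   space is extracted. *)
move=> i j; apply: (holder_loc_slice_continuous _ _ _ t alpha0 (p2h i j)).
by rewrite /= in_itv /= st.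
Qed.

End Coefficients.

(** * The squared Euclidean distance as a smooth barrier *)

Lemma is_derive_coord (R : realType) (d : nat) (i : 'I_d) (x v : 'rV[R]_d) :
  is_derive x v (fun z : 'rV[R]_d => z 0 i) (v 0 i).
Proof.
suff L : h^-1 *: ((h *: v + x) 0 i - x 0 i) @[h --> (0:R)^'] --> v 0 i.
  by split; [apply/cvg_ex; eexists; exact: L|exact: cvg_lim L].
apply: cvg_near_cst; near=> h.
have h0 : h != 0 by near: h; exact: nbhs_dnbhs_neq.
by rewrite !mxE addrK [_ *: _]mulKf.
Unshelve. all: by end_near. Qed.

Section SquaredDistance.
Variables (R : realType) (d : nat) (x0 : 'rV[R]_d).
Let h (x : 'rV[R]_d) := eucl2 (x - x0).

Lemma C2_sqdist : C2 h.
Proof.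
have dcoord (i : 'I_d) (x v : 'rV[R]_d) :
    is_derive x v (fun z : 'rV[R]_d => z 0 i - x0 0 i) (v 0 i).
  have := is_deriveB (is_derive_coord R d i x v) (is_derive_cst (x0 0 i) x v).
  by rewrite subr0.
have dh (x v : 'rV[R]_d) :
    is_derive x v h (\sum_(i < d) 2 * (x 0 i - x0 0 i) * v 0 i).
  pose F (i : 'I_d) := (fun z : 'rV[R]_d => z 0 i - x0 0 i) ^+ 2.
  have -> : h = \sum_(i < d) F i.
    apply/funext => z; rewrite fct_sumE /h /eucl2; apply: eq_bigr => i _.
    by rewrite /F !mxE expr2.
  have dF i : is_derive x v (F i) (2 * (x 0 i - x0 0 i) * v 0 i).
    by apply: is_derive_eq (is_deriveX 2 (dcoord i x v)) _; rewrite expr1.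
  exact: is_derive_sum.
have ph i : partial i h = (fun x => 2 * (x 0 i - x0 0 i)).
  apply/funext => x; rewrite /partial; have [_ ->] := dh x (evec R i).
  rewrite (bigD1 i) //= big1 ?addr0; first by rewrite mxE !eqxx mulr1.
  by move=> j /negPf ji; rewrite mxE ji andbF mulr0.
have dph i (x v : 'rV[R]_d) : is_derive x v (fun x => 2 * (x 0 i - x0 0 i)) (2 * v 0 i).
  exact: (is_deriveZ 2 (dcoord i x v)).
have pph i j : partial i (partial j h) = (fun _ => 2 * evec R i 0 j).
  by apply/funext => x; rewrite ph /partial; have [_ ->] := dph j x (evec R i).
have coordc i : continuous (fun x : 'rV[R]_d => x 0 i - x0 0 i).
  by move=> x; apply: (@cvgB _ _ _ (nbhs x)); [exact: coord_continuous|exact: cvg_cst].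
split.
  have -> : h = (fun x => \sum_(i < d) (x 0 i - x0 0 i) * (x 0 i - x0 0 i)).
    by apply/funext => x; apply: eq_bigr => i _; rewrite !mxE expr2.
  apply: continuous_big; first exact: add_continuous.
  by move=> i _ x; apply: (@cvgM _ _ (nbhs x)); exact: coordc.
split; first by move=> i x; case: (dh x (evec R i)).
split; first by move=> i; rewrite ph => x; apply: (@cvgMl_tmp _ _ (nbhs x)); exact: coordc.
split; first by move=> i j x; rewrite ph; case: (dph j x (evec R i)).
by move=> i j; rewrite pph; exact: cst_continuous.
Qed.

Lemma sqdist_ge0 x : 0 <= h x.
Proof. by apply: sumr_ge0 => i _; exact: sqr_ge0. Qed.

(** The norm of ['rV[R]_d] is the maximum norm: it equals some coordinate in absolute value, and the
    square of that coordinate is one summand of [h]. *)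
Lemma sqdist_ge (x : 'rV[R]_d) : `|x - x0| ^+ 2 <= h x.
Proof.
have [->|n0] := eqVneq `|x - x0| 0; first by rewrite expr0n sqdist_ge0.
have [[k i] /= xi] := mx_norm_neq0 n0.
have -> : `|x - x0| = `|(x - x0) 0 i|.
  by rewrite (ord1 k) in xi; exact: xi.
rewrite real_normK ?num_real // /h /eucl2 (bigD1 i) //= lerDl.
by apply: sumr_ge0 => j _; exact: sqr_ge0.
Qed.

Lemma sqdist_center : h x0 = 0.
Proof. by rewrite /h subrr /eucl2 big1 // => i _; rewrite mxE expr0n. Qed.

End SquaredDistance.

(** * Estimates uniform in the starting time *)

Section Evolution.
Variables (R : realType) (d : nat).
Notation V := 'rV[R]_d.
Variables (q : 'I_d -> 'I_d -> R -> V -> R) (b : 'I_d -> R -> V -> R).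
Variables (c : R -> V -> R) (c0 a T : R) (phi : V -> R) (lam : R).
Hypothesis q_sym : forall i j t x, a <= t <= T -> q i j t x = q j i t x.
Hypothesis q_psd : forall t x xi, a <= t <= T -> 0 <= qform (fun i j => q i j t x) xi.
Hypothesis c_ge : forall t x, a <= t <= T -> c0 <= c t x.
Hypothesis phi_C2 : C2 phi.
Hypothesis phi_gt0 : forall x, 0 < phi x.
Hypothesis phi_infty : to_infty phi.
Hypothesis phi_super : forall t x, a <= t <= T -> Aop q b c t phi x <= lam * phi x.

Lemma Aop_cst (k t : R) (x : V) : Aop q b c t (fun _ => k) x = - (c t x * k).
Proof.
have p0 k' i : partial i (fun _ : V => k') = (fun _ => 0).
  by apply/funext => z; rewrite /partial -[fun _ => k']/(cst k') derive_cst.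
rewrite /Aop /Aop0 big1 ?add0r; last first.
  by move=> i _; rewrite big1 // => j _; rewrite !p0 mulr0.
by rewrite big1 ?add0r // => i _; rewrite p0 mulr0.
Qed.

(** The function [expR (k * (t - m)) * g x] is a supersolution, so the whole-space principle applies
    to its sum with [y] and with [- y]. The conclusion does not contain [B]: a strip bound depending
    on the solution is good enough. *)
Lemma solution_le_super (m k B : R) (y : R -> V -> R) (g : V -> R) :
  a <= m -> C12 R d m y ->
  (forall t x, m < t <= T -> parab R d q b c y t x = 0) ->
  (forall t x, m <= t <= T -> `|y t x| <= B) ->
  C2 g -> (forall x, 0 <= g x) ->
  (forall t x, m < t <= T -> Aop q b c t g x <= k * g x) ->
  (forall x, `|y m x| <= g x) ->
  forall t x, m <= t <= T -> `|y t x| <= expR (k * (t - m)) * g x.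
Proof.
move=> am y12 y_sol yB g2 g0 g_super y_init t x tmT.
have sub u : m < u <= T -> a <= u <= T.
  by move=> /andP[mu ->]; rewrite (le_trans am (ltW mu)).
pose e (u : R) := expR (k * (u - m)).
have [eg12 egE] := C12_prod R d q b c m e (fun u => k * e u) g
  (is_derive_expR_affine R k m) g2.
suff one_sided sg : `|sg| = 1 -> 0 <= (- sg) * y t x + e t * g x.
  have := one_sided 1 (normr1 R); have := one_sided (- 1).
  rewrite normrN normr1 => /(_ erefl) h1 h2; rewrite ler_norml; apply/andP.
  by split; move: h1 h2; rewrite /e; lra.
move=> sg1; have sgB w : (- sg) * w >= - `|w|.
  by rewrite lerNl (le_trans (ler_norm _)) // !normrN normrM normrN sg1 mul1r.
refine (max_principle_Lyapunov R d q b c c0 m T _ _ _ phi lam B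
  (fun t x => (- sg) * y t x + e t * g x) phi_C2 phi_gt0 phi_infty
  _ _ _ _ _ t x tmT).
- by move=> i j u z /sub; exact: q_sym.
- by move=> u z xi /sub; exact: q_psd.
- by move=> u z /sub; exact: c_ge.
- by move=> u z /sub; exact: phi_super.
- exact: C12_lin.
- move=> z; have := y_init z; have := sgB (y m z).
  by rewrite /e subrr mulr0 expR0 mul1r; lra.
- move=> u z uT; have := yB u z uT; have := sgB (y u z).
  have : 0 <= e u * g z by rewrite mulr_ge0 // expR_ge0.
  by lra.
- move=> u z uT; have mu : m < u by case/andP: uT.
  rewrite (parab_lin R d q b c m) // y_sol // mulr0 add0r egE.
  by rewrite (mulrC k) -mulrA -mulrBr mulr_ge0 ?expR_ge0 // subr_ge0 g_super.
Qed.

Variables (alpha : R) (D : set R).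
Hypothesis alpha_gt0 : 0 < alpha.
Hypothesis aTD : `[a, T] `<=` D.
Hypothesis q_holder : forall i j, holder_loc alpha D (q i j).
Hypothesis b_holder : forall i, holder_loc alpha D (b i).
Hypothesis c_holder : holder_loc alpha D c.
Variables (f : V -> R) (K : R) (U : R -> R -> V -> R).
Hypothesis f_continuous : continuous f.
Hypothesis f_bounded : forall x, `|f x| <= K.
Hypothesis U_sol : forall s, a <= s -> is_solution alpha q b c s f (U s).

Let K1 := expR (`|c0| * (T - a)) * K.

(** Comparison with the constant [K], whose growth rate is [|c0|] because [- c <= |c0|]; the elapsed
    time is at most [T - a], so the bound is the same for all [s]. *)
Lemma U_bounded (s t : R) (x : V) : a <= s -> s <= t <= T -> `|U s t x| <= K1.
Proof.
move=> as_ stT; have [U12 Usol] := is_solution_C12 R d _ _ _ _ s _ _ alpha_gt0 (U_sol s as_).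
have [_ [Ub [_ [_ [_ [_ [_ [_ U0]]]]]]]] := U_sol s as_.
have [M UM] := Ub T.
have K0 : 0 <= K by apply: le_trans (f_bounded x).
have := solution_le_super s `|c0| M (U s) (fun _ => K) as_ U12.
move=> /(_ _ UM (C2_cst R d K) (fun _ => K0)) H.
have {}H : `|U s t x| <= expR (`|c0| * (t - s)) * K.
  apply: H => //.
  - by move=> u z /andP[su _]; exact: Usol.
  - move=> u z /andP[su uT]; rewrite Aop_cst -mulNr ler_wpM2r //.
    have : c0 <= c u z by apply: c_ge; rewrite uT andbT (le_trans as_ (ltW su)).
    by have := ler_norm (- c0); rewrite normrN; lra.
  - by move=> z; rewrite U0.
apply: (le_trans H); rewrite ler_wpM2r // ler_expR ler_wpM2l //.
by case/andP: stT; lra.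
Qed.

(* The constants do not depend on s: this yields continuity at the diagonal. *)
Lemma U_barrier (x0 : V) (eps : R) : 0 < eps ->
  exists C N rho tau : R, [/\ 0 < rho, 0 < tau &
    forall s t x, a <= s -> s <= t <= T -> t - s <= tau -> `|x - x0| <= rho ->
      `|U s t x - f x0| <= eps + C * eucl2 (x - x0) + N * (t - s)].
Proof.
move=> eps0.
have K0 : 0 <= K by apply: le_trans (f_bounded x0).
have K1_ge0 : 0 <= K1 by rewrite mulr_ge0 ?expR_ge0.
have [rho rho0 f_near] : exists2 rho, 0 < rho &
    forall x, `|x - x0| <= rho -> `|f x - f x0| <= eps.
  have /(@cvgrPdist_le _ _ _ (nbhs x0))/(_ eps eps0)/nbhs_ballP[r /= r0 fr] :=
    f_continuous x0.
  exists (r / 2); first by rewrite divr_gt0.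
  move=> x xr; rewrite distrC; apply: fr; rewrite -ball_normE /= distrC.
  by apply: le_lt_trans xr _; lra.
pose h x := eucl2 (x - x0).
pose r := `|x0| + rho.
have [B0 B0_ge0 cB] := cyl_bounded_holder R d a T r alpha D c alpha_gt0 c_holder aTD.
have [B1 B1_ge0 hB] := cyl_bounded_Aop R d a T r alpha D q b c h
  alpha_gt0 aTD q_holder b_holder c_holder (C2_sqdist R d x0).
(* On the lateral boundary [C * h] is then at least [K1 + K], which bounds [|U s t x - f x0|]. *)
pose C := (K1 + K) / rho ^+ 2.
have C0 : 0 <= C by rewrite divr_ge0 ?addr_ge0 ?sqr_ge0.
(* Half of [N] outweighs the operator applied to the spatial part of the barrier. The other half
   pays for the zero-order term of [N * (t - s)], which is at most [N / 2] because
   [tau * B0 <= 1 / 2]. *)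
pose N := 2 * ((K + eps) * B0 + C * B1).
have N0 : 0 <= N.
  by rewrite mulr_ge0 // addr_ge0 // mulr_ge0 // addr_ge0 // ltW.
pose tau := (2 * (B0 + 1))^-1.
have tau0 : 0 < tau by rewrite invr_gt0 mulr_gt0 // ltr_wpDl.
exists C, N, rho, tau; split=> // s t x as_ stT st_tau xrho.
have tT : t <= T by case/andP: stT.
have sub u : s < u <= t -> a <= u <= T.
  by move=> /andP[su ut]; rewrite (le_trans as_ (ltW su)) (le_trans ut tT).
have [U12 Usol] := is_solution_C12 R d _ _ _ _ s _ _ alpha_gt0 (U_sol s as_).
have [_ [_ [_ [_ [_ [_ [_ [_ U0]]]]]]]] := U_sol s as_.
(* Both signs of the difference are treated at once. The factors 1 give the barrier the shape
   produced by [C12_lin] and [C12_prod]. *)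
suff one_sided sg : `|sg| = 1 ->
    0 <= (- sg) * U s t x + (1 * (1 * (C * h x + (eps + sg * f x0))) + (t - s) * N).
  have := one_sided 1 (normr1 R); have := one_sided (- 1).
  rewrite normrN normr1 => /(_ erefl) h1 h2; rewrite ler_norml; apply/andP.
  by split; move: h1 h2; rewrite /h; lra.
move=> sg1.
have sgB w M : `|w| <= M -> - M <= sg * w <= M.
  by move=> wM; rewrite -ler_norml normrM sg1 mul1r.
pose k := eps + sg * f x0.
pose g x := C * h x + k.
have g2 : C2 g by apply: C2_lin; [exact: C2_sqdist|exact: C2_cst].
have d1 (u : R) : is_derive u 1 (fun _ : R => (1 : R)) 0 by exact: is_derive_cst.
have ds (u : R) : is_derive u 1 (fun v : R => v - s) 1.
  apply: is_derive_eq (is_deriveB (is_derive_id u 1) (is_derive_cst s u 1)) _.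
  by rewrite subr0.
have [g12 gE] := C12_prod R d q b c s _ _ g d1 g2.
have [n12 nE] := C12_prod R d q b c s _ _ (fun _ => N) ds (C2_cst R d N).
have v12 := C12_lin R d s 1 _ _ g12 n12.
have stt : s <= t <= t by rewrite lexx andbT; case/andP: stT.
(* The cylinder ends at [t] and not at [T], so that the elapsed time never exceeds [tau]. *)
refine (max_principle_cylinder R d q b c c0 s t _ _ _ x0 rho
  (fun t x => (- sg) * U s t x + (1 * (1 * g x) + (t - s) * N))
  _ _ _ _ t x stt xrho).
- by move=> i j u z /sub; exact: q_sym.
- by move=> u z xi /sub; exact: q_psd.
- by move=> u z /sub; exact: c_ge.
- exact: C12_lin.
- move=> z zrho; rewrite U0 subrr mul0r addr0 !mul1r /g /k.
  have /sgB/andP[_] := f_near z zrho.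
  have : 0 <= C * h z by rewrite mulr_ge0 // sqdist_ge0.
  by lra.
- move=> u z sut zrho; have /andP[su ut] := sut.
  have uT : s <= u <= T by rewrite su (le_trans ut tT).
  have /sgB/andP[_ hU] := U_bounded s u z as_ uT.
  have /sgB/andP[hf _] := f_bounded x0.
  have hN : 0 <= (u - s) * N by rewrite mulr_ge0 // subr_ge0.
  have hC : K1 + K <= C * h z.
    have -> : K1 + K = C * rho ^+ 2 by rewrite /C divfK // sqrf_eq0 gt_eqF.
    by rewrite ler_wpM2l // -zrho; exact: sqdist_ge.
  by rewrite !mul1r /g /k; lra.
- move=> u z sut zrho; have /andP[su ut] := sut.
  have zr : `|z| <= r.
    rewrite -[z in `|z|](subrK x0) addrC (le_trans (ler_normD _ _)) //.
    by rewrite lerD2l ltW.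
  rewrite (parab_lin R d q b c s) // Usol // mulr0 add0r.
  rewrite (parab_lin R d q b c s) // gE nE mul0r !mul1r sub0r.
  rewrite /g Aop_lin; [|exact: C2_sqdist|exact: C2_cst].
  rewrite !Aop_cst.
  have hc := cB u z (sub u sut) zr; have hA := hB u z (sub u sut) zr.
  have hck : `|c u z * k| <= B0 * (K + eps).
    rewrite normrM ler_pM // /k addrC (le_trans (ler_normD _ _)) //.
    by rewrite lerD ?(gtr0_norm eps0) // normrM sg1 mul1r.
  have hCA : C * Aop q b c u h z <= C * B1.
    by rewrite ler_wpM2l // (le_trans (ler_norm _)).
  have hcN : `|(u - s) * (c u z * N)| <= N / 2.
    have us0 : 0 <= u - s by rewrite subr_ge0 ltW.
    rewrite mulrA normrM (ger0_norm N0) mulrC ler_wpM2l // normrM (ger0_norm us0).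
    apply: (@le_trans _ _ (tau * B0)); first by rewrite ler_pM //; lra.
    rewrite /tau mulrC ler_pdivrMr ?mulr_gt0 ?ltr_wpDl //; lra.
  have := ler_norm (- (c u z * k)); have := ler_norm (- ((u - s) * (c u z * N))).
  have : 0 <= N / 2 - (B0 * (K + eps) + C * B1) by rewrite /N; lra.
  rewrite !normrN mulrN; lra.
Qed.

(** Four quarters of [eps]: the slack of the barrier, its quadratic term, its linear term in time,
    and the variation of [f] near [x0]. Separating the neighbourhoods of [x] and of the times
    prepares the covering argument that makes this uniform on balls. *)
Lemma U_diagonal (s0 : R) (x0 : V) (eps : R) : 0 < eps ->
  \forall x \near x0 & p \near (s0, s0),
    a <= p.2 -> p.2 <= p.1 <= T -> `|U p.2 p.1 x - f x| <= eps.
Proof.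
move=> eps0; have e4 : 0 < eps / 4 by rewrite divr_gt0.
have [C [N [rho [tau [rho0 tau0 UB]]]]] := U_barrier x0 (eps / 4) e4.
pose h x := eucl2 (x - x0).
near=> x p => ap ptT.
have : `|f x0 - f x| <= eps / 4.
  by near: x; apply: (@cvgr_dist_le _ _ _ (nbhs x0)) => //; exact: f_continuous.
have hC : `|0 - C * h x| <= eps / 4.
  near: x; apply: (@cvgr_dist_le _ _ _ (nbhs x0)) => //.
  rewrite -(mulr0 C) -(sqdist_center R d x0); apply: (@cvgMl_tmp _ _ (nbhs x0)).
  by have [hc _] := C2_sqdist R d x0; exact: hc.
have hN : `|0 - N * (p.1 - p.2)| <= eps / 4.
  near: p; apply: (@cvgr_dist_le _ _ _ (nbhs (s0, s0))) => //.
  rewrite -(mulr0 N) -(subrr s0); apply: (@cvgMl_tmp _ _ (nbhs (s0, s0))).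
  by apply: (@cvgB _ _ _ (nbhs (s0, s0))); [exact: cvg_fst|exact: cvg_snd].
have htau : `|0 - (p.1 - p.2)| <= tau.
  near: p; apply: (@cvgr_dist_le _ _ _ (nbhs (s0, s0))) => //.
  rewrite -(subrr s0).
  by apply: (@cvgB _ _ _ (nbhs (s0, s0))); [exact: cvg_fst|exact: cvg_snd].
have xrho : `|x - x0| <= rho.
  rewrite distrC.
  by near: x; apply: (@cvgr_dist_le _ _ _ (nbhs x0)) => //; exact: cvg_id.
have ptau : p.1 - p.2 <= tau.
  by have := ler_norm (- (0 - (p.1 - p.2))); rewrite normrN; lra.
have := UB p.2 p.1 x ap ptT ptau xrho.
move: hC hN; rewrite /h !ler_norml => /andP[hC1 hC2] /andP[hN1 hN2].
by move=> /andP[u1 u2] /andP[f1 f2]; apply/andP; split; lra.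
Unshelve. all: by end_near. Qed.

Lemma U_diagonal_unif (s0 r eps : R) : 0 < eps ->
  \forall p \near (s0, s0), forall x, `|x| <= r ->
    a <= p.2 -> p.2 <= p.1 <= T -> `|U p.2 p.1 x - f x| <= eps.
Proof.
move=> eps0; have /compact_near_coveringP cov := closed_ball_compact_rV R d 0 r.
have := cov _ (nbhs (s0, s0)) (fun p x => a <= p.2 -> p.2 <= p.1 <= T ->
  `|U p.2 p.1 x - f x| <= eps) (nbhs_filter (s0, s0))
  (fun x _ => U_diagonal s0 x eps eps0).
by apply: filterS => p Pp x xr; apply: Pp; rewrite /= subr0.
Qed.

(** From [m] on the difference is a solution. In the rate, [|lam|] accounts for [phi] and [|c0|] for
    the constant [e0]. *)
Lemma U_compare (s1 s2 m e0 e1 : R) :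
  a <= s1 -> a <= s2 -> s1 <= m -> s2 <= m -> 0 <= e0 -> 0 <= e1 ->
  (forall x, `|U s1 m x - U s2 m x| <= e1 * phi x + e0) ->
  forall t x, m <= t <= T ->
    `|U s1 t x - U s2 t x| <=
      expR ((`|c0| + `|lam|) * (t - m)) * (e1 * phi x + e0).
Proof.
move=> as1 as2 s1m s2m e0_ge0 e1_ge0 Um t x tmT.
have [U12 Usol] := is_solution_C12 R d _ _ _ _ s1 _ _ alpha_gt0 (U_sol s1 as1).
have [W12 Wsol] := is_solution_C12 R d _ _ _ _ s2 _ _ alpha_gt0 (U_sol s2 as2).
have am : a <= m by exact: le_trans s1m.
have {}U12 := C12_le R d _ _ _ s1m U12; have {}W12 := C12_le R d _ _ _ s2m W12.
have E : U s1 t x - U s2 t x = (- 1) * U s2 t x + U s1 t x by ring.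
rewrite E.
refine (solution_le_super m (`|c0| + `|lam|) (K1 + K1)
  (fun t x => (- 1) * U s2 t x + U s1 t x) (fun x => e1 * phi x + e0) am
  (C12_lin R d m (- 1) _ _ W12 U12) _ _ _ _ _ _ t x tmT).
- move=> u z muT; have /andP[mu uT] := muT.
  rewrite (parab_lin R d q b c m) // Usol ?Wsol ?mulr0 ?addr0 //.
    exact: le_lt_trans mu.
  exact: le_lt_trans mu.
- move=> u z /andP[mu uT]; rewrite mulN1r (le_trans (ler_normD _ _)) // normrN.
  by rewrite lerD // U_bounded // uT andbT (le_trans _ mu).
- exact: C2_lin phi_C2 (C2_cst R d e0).
- by move=> z; rewrite addr_ge0 // mulr_ge0 // ltW.
- move=> u z /andP[mu uT].
  have auT : a <= u <= T by rewrite uT (le_trans am (ltW mu)).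
  rewrite Aop_lin; [|exact: phi_C2|exact: C2_cst].
  rewrite Aop_cst -mulNr.
  have h1 : e1 * Aop q b c u phi z <= (`|c0| + `|lam|) * (e1 * phi z).
    rewrite mulrCA ler_wpM2l // (le_trans (phi_super u z auT)) //.
    apply: ler_wpM2r; first exact: ltW.
    by have := ler_norm lam; have := normr_ge0 c0; lra.
  have h2 : - c u z * e0 <= (`|c0| + `|lam|) * e0.
    rewrite ler_wpM2r //; have := c_ge u z auT; have := ler_norm (- c0).
    by rewrite normrN; have := normr_ge0 lam; lra.
  by rewrite [leRHS]mulrDr; exact: lerD.
- by move=> z; have := Um z; rewrite mulN1r addrC.
Qed.

Lemma U_continuous_start (s0 r eps : R) : a <= s0 -> s0 < T -> 0 < eps ->
  \forall s \near s0, a <= s -> forall t x, s <= t <= T -> s0 <= t ->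
    `|x| <= r -> `|U s t x - U s0 t x| <= eps.
Proof.
move=> as0 s0T eps0.
have [P P0 phiP] : cyl_bounded R d a T r (fun _ => phi).
  by apply: cyl_bounded_continuous; case: phi_C2.
have K0 : 0 <= K by apply: le_trans (f_bounded 0).
have K1_ge0 : 0 <= K1 by rewrite mulr_ge0 ?expR_ge0.
pose E := expR ((`|c0| + `|lam|) * (T - a)).
have E0 : 0 < E by exact: expR_gt0.
(* Chosen so that [E * e0] and [E * (e1 * (P + 1))] are both [eps / 2], where [E] bounds the
   exponential growth and [P] bounds [phi] on the ball of radius [r]. *)
pose e0 := eps / (2 * E); pose e1 := eps / (2 * E * (P + 1)).
have e0_gt0 : 0 < e0 by rewrite divr_gt0 // mulr_gt0.
have P1 : 0 < P + 1 by rewrite ltr_wpDl.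
have e1_gt0 : 0 < e1 by rewrite divr_gt0 // !mulr_gt0.
have [rho rhoP] := phi_infty ((K1 + K1) / e1).
have e02 : 0 < e0 / 2 by rewrite divr_gt0.
have unif := U_diagonal_unif s0 rho (e0 / 2) e02.
(* As [s] may lie on either side of [s0], the comparison starts at the larger one; paired with [s]
   or with [s0] it tends to the diagonal, so both solutions are near [f] there. *)
have cmax : Num.max s s0 @[s --> s0] --> s0.
  have idc : {for s0, continuous (@idfun R)} by exact: cvg_id.
  have : Num.max s s0 @[s --> s0] --> Num.max s0 s0.
    exact: continuous_max idc (@cst_continuous R R s0 s0).
  by rewrite maxxx.
have c1 : (Num.max s s0, s) @[s --> s0] --> (s0, s0).
  by apply: (@cvg_pair _ _ _ (nbhs s0) (nbhs s0) (nbhs s0)); last exact: cvg_id.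
have c2 : (Num.max s s0, s0) @[s --> s0] --> (s0, s0).
  by apply: (@cvg_pair _ _ _ (nbhs s0) (nbhs s0) (nbhs s0)); last exact: cvg_cst.
near=> s => as_ t x stT s0t xr.
pose m := Num.max s s0.
have sm : s <= m by rewrite le_max lexx.
have s0m : s0 <= m by rewrite le_max lexx orbT.
have mt : m <= t by rewrite ge_max s0t; case/andP: stT => ->.
have tT : t <= T by case/andP: stT.
have mT : m <= T by exact: le_trans tT.
have u1 : forall z, `|z| <= rho -> a <= s -> s <= m <= T ->
    `|U s m z - f z| <= e0 / 2.
  by rewrite /m; near: s; exact: c1 unif.
have u2 : forall z, `|z| <= rho -> a <= s0 -> s0 <= m <= T ->
    `|U s0 m z - f z| <= e0 / 2.
  by rewrite /m; near: s; exact: c2 unif.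
(* Inside the ball each solution is within [e0 / 2] of [f]; outside, [e1 * phi z] exceeds [K1 + K1],
   which bounds the difference. *)
have at_m z : `|U s m z - U s0 m z| <= e1 * phi z + e0.
  have [zr|zr] := leP `|z| rho.
    have := u1 z zr as_; rewrite sm mT => /(_ isT) h1.
    have := u2 z zr as0; rewrite s0m mT => /(_ isT) h2.
    have phi0 : 0 <= e1 * phi z by rewrite mulr_ge0 // ltW.
    move: h1 h2; rewrite !ler_norml => /andP[h1 h2] /andP[h3 h4].
    by apply/andP; split; lra.
  have := rhoP z zr; rewrite ltr_pdivrMr // mulrC => h1.
  have h2 := U_bounded s m z as_; rewrite sm mT in h2.
  have h3 := U_bounded s0 m z as0; rewrite s0m mT in h3.
  have := ler_normB (U s m z) (U s0 m z); have := h2 isT; have := h3 isT.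
  by lra.
have mtT : m <= t <= T by rewrite mt.
have := U_compare s s0 m e0 e1 as_ as0 sm s0m (ltW e0_gt0) (ltW e1_gt0) at_m t x mtT.
move=> /le_trans; apply.
have phix : phi x <= P.
  have := phiP s0 x; rewrite as0 (ltW s0T) => /(_ isT xr).
  by apply: le_trans; exact: ler_norm.
apply: (@le_trans _ _ (E * (e1 * (P + 1) + e0))).
  apply: ler_pM; first exact: expR_ge0.
  - by apply: addr_ge0; [apply: mulr_ge0|]; exact: ltW.
  - rewrite /E ler_expR ler_wpM2l ?addr_ge0 //.
    by have := le_trans as0 s0m; lra.
  - by rewrite lerD2r ler_wpM2l ?(ltW e1_gt0) //; lra.
have -> // : E * (e1 * (P + 1) + e0) = eps.
rewrite /e1 /e0; field.
by rewrite !gt_eqF.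
Unshelve. all: by end_near. Qed.

End Evolution.

(** * Joint continuity *)

(** The estimates live on a closed interval [[a, T]] within [I] that must contain all admissible
    starting times near [s0]. A closed left end of [I] can itself be [a], even if it equals [s0];
    otherwise there is room strictly below [s0]. *)
Lemma right_unbounded_anchor (R : realType) (I : set R) (s0 : R) :
  (I = setT \/ exists a : R, I = [set` `[a, +oo[] \/ I = [set` `]a, +oo[]) ->
  I s0 -> exists a, [/\ a <= s0, forall t, a <= t -> I t &
    \forall s \near s0, I s -> a <= s].
Proof.
have below (a : R) : a < s0 -> \forall s \near s0, I s -> a <= s.
  move=> as0; have : \forall s \near s0, a < s by exact: lt_nbhsr.
  by apply: filterS => s /ltW.
move=> [IE|[a [IE|IE]]] Is0.
- exists (s0 - 1); rewrite gerBl; split=> //; first by rewrite IE.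
  by apply: below; rewrite gtrBl.
- exists a; move: Is0; rewrite IE /= in_itv /= andbT => as0; split=> //.
    by move=> t; rewrite /= in_itv /= andbT.
  by apply: (@nearW _ (nbhs s0)) => s; rewrite /= in_itv /= andbT.
- have as0 : a < s0 by move: Is0; rewrite IE /= in_itv /= andbT.
  exists ((a + s0) / 2); split; first by lra.
    by move=> t; rewrite IE /= in_itv /= andbT; lra.
  by apply: below; lra.
Qed.

Theorem theorem4p11 (R : realType) (d : nat) (alpha : R) (I : set R)
  (q : 'I_d -> 'I_d -> R -> 'rV[R]_d -> R) (b : 'I_d -> R -> 'rV[R]_d -> R)
  (c : R -> 'rV[R]_d -> R) (eta : R -> 'rV[R]_d -> R)
  (f : 'rV[R]_d -> R) (U : R -> R -> 'rV[R]_d -> R) :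
  (0 < d)%N -> 0 < alpha < 1 ->
  (I = setT \/ exists a : R, I = [set` `[a, +oo[] \/ I = [set` `]a, +oo[]) ->
  (* regularity of the coefficients *)
  (forall i j, holder_loc alpha I (q i j)) ->
  (forall i, holder_loc alpha I (b i)) ->
  holder_loc alpha I c ->
  (exists c0 : R, forall t x, I t -> c0 <= c t x) ->
  (* symmetry and uniform ellipticity *)
  (forall i j t x, I t -> q i j t x = q j i t x) ->
  (forall t x xi, I t -> eta t x * eucl2 xi <= qform (fun i j => q i j t x) xi) ->
  (exists eta0 : R, 0 < eta0 /\ forall t x, I t -> eta0 <= eta t x) ->
  (* standing Lyapunov hypothesis *)
  (forall J, bounded_interval J -> J `<=` I ->
     exists (phi : 'rV[R]_d -> R) (lam : R),
       C2 phi /\ (forall x, 0 < phi x) /\ to_infty phi /\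
       forall t x, J t -> Aop q b c t phi x <= lam * phi x) ->
  (* (H') *)
  (forall J, bounded_interval J -> J `<=` I ->
     exists (psi : 'rV[R]_d -> R) (lam : R),
       C2 psi /\ (forall x, 0 < psi x) /\ to_infty psi /\
       forall t x, J t -> Aop0 q b t psi x - lam * psi x <= 0) ->
  (* (H'') *)
  (forall J, bounded_interval J -> J `<=` I ->
     exists (phi : 'rV[R]_d -> R) (M : R),
       C2 phi /\ (forall x, 0 < phi x) /\ to_infty phi /\ 0 < M /\
       forall t x, J t -> Aop q b c t phi x <= M) ->
  (* f in C_b(R^d) *)
  continuous f -> (exists K : R, forall x, `|f x| <= K) ->
  (* U s = (t,x) |-> (G(t,s) f)(x), the solution started at time s *)
  (forall s, I s -> is_solution alpha q b c s f (U s)) ->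
  {within [set p : R * R * 'rV[R]_d | [/\ I p.1.1, I p.1.2 & p.1.2 <= p.1.1]],
     continuous (fun p : R * R * 'rV[R]_d => U p.1.2 p.1.1 p.2)}.
Proof.
move=> _ /andP[alpha0 _] I_shape qh bh ch [c0 c_ge] q_sym q_ell [eta0 [eta0_gt0 eta_ge]].
move=> lyap _ _ fc [K fK] Usol.
apply/subspace_continuousP => -[[t0 s0] x0] [/= It0 Is0 s0t0].
have [a [as0 aI near_a]] := right_unbounded_anchor R I s0 I_shape Is0.
pose T := t0 + 1.
have aTI : `[a, T] `<=` I by move=> t /=; rewrite in_itv /= => /andP[/aI].
have [|phi [lam [phi2 [phi_gt0 [phi_infty phi_super]]]]] := lyap `[a, T]%classic _ aTI.
  by split; [exact: interval_is_interval|exists a, T].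
have inI t : a <= t <= T -> I t by move=> /andP[/aI].
have q_sym' i j t x : a <= t <= T -> q i j t x = q j i t x by move=> /inI; exact: q_sym.
have q_psd t x xi : a <= t <= T -> 0 <= qform (fun i j => q i j t x) xi.
  move=> /inI It; apply: le_trans (q_ell t x xi It); apply: mulr_ge0.
    exact: le_trans (ltW eta0_gt0) (eta_ge t x It).
  by apply: sumr_ge0 => i _; exact: sqr_ge0.
have c_ge' t x : a <= t <= T -> c0 <= c t x by move=> /inI; exact: c_ge.
have phi_super' t x : a <= t <= T -> Aop q b c t phi x <= lam * phi x.
  by move=> atT; apply: phi_super; rewrite /= in_itv.
have Usol' s : a <= s -> is_solution alpha q b c s f (U s).
  by move=> /aI; exact: Usol.
apply/(@cvgrPdist_le _ _ _ (within _ (nbhs (t0, s0, x0)))) => eps eps0.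
rewrite near_withinE.
suff : \forall p \near (t0, s0, x0),
    [/\ I (p : R * R * 'rV[R]_d).1.1, I p.1.2 & p.1.2 <= p.1.1] ->
    `|U s0 t0 x0 - U p.1.2 p.1.1 p.2| <= eps by [].
have cvg_t : (p : R * R * 'rV[R]_d).1.1 @[p --> (t0, s0, x0)] --> t0.
  exact: cvg_comp cvg_fst cvg_fst.
have cvg_s : (p : R * R * 'rV[R]_d).1.2 @[p --> (t0, s0, x0)] --> s0.
  exact: cvg_comp cvg_fst cvg_snd.
have cvg_x : (p : R * R * 'rV[R]_d).2 @[p --> (t0, s0, x0)] --> x0.
  exact: cvg_snd.
have near_T : \forall p \near (t0, s0, x0), (p : R * R * 'rV[R]_d).1.1 <= T.
  have tT : \forall t \near t0, t <= T.
    have : \forall t \near t0, t < T by apply: lt_nbhsl; rewrite ltrDl.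
    by apply: filterS => t /ltW.
  exact: cvg_t _ tT.
have near_a' := cvg_s _ near_a.
have e2 : 0 < eps / 2 by rewrite divr_gt0.
(* On the diagonal, nearby times may precede [s0], where [U s0] is not governed by the equation, so
   the reference there is [f]. Off the diagonal nearby times stay above [s0], and [U s0] at the
   nearby point serves as the intermediate value. *)
move: s0t0; rewrite le_eqVlt => /orP[/eqP s0t0|s0t0].
  have diag := U_diagonal R d q b c c0 a T phi lam q_sym' q_psd c_ge' phi2 phi_gt0
    phi_infty phi_super' alpha I alpha0 aTI qh bh ch f K U fc fK Usol' s0 x0 _ e2.
  have U0 : U s0 t0 x0 = f x0.
    by rewrite -s0t0; have [_ [_ [_ [_ [_ [_ [_ [_ ->]]]]]]]] := Usol s0 Is0.
  have swap : ((p : R * R * 'rV[R]_d).2, p.1) @[p --> (t0, s0, x0)] -->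
      (x0, (s0, s0)).
    apply: (@cvg_pair _ _ _ (nbhs (t0, s0, x0)) (nbhs x0) (nbhs (s0, s0))).
      exact: cvg_snd.
    by rewrite -s0t0; exact: cvg_fst.
  have {}diag := swap _ diag.
  have fx0 : \forall x \near x0, `|f x0 - f x| <= eps / 2.
    by apply: (@cvgr_dist_le _ _ _ (nbhs x0)) => //; exact: fc.
  near=> p => -[Ipt Ips pst].
  have fx : `|f x0 - f p.2| <= eps / 2 by near: p; exact: cvg_x _ fx0.
  have ap : a <= p.1.2 by move: Ips; near: p.
  have pT : p.1.1 <= T by near: p.
  have : a <= p.1.2 -> p.1.2 <= p.1.1 <= T -> `|U p.1.2 p.1.1 p.2 - f p.2| <= eps / 2.
    by near: p; exact: diag.
  rewrite pst pT U0 => /(_ ap isT).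
  by move: fx; rewrite !ler_norml => /andP[f1 f2] /andP[u1 u2]; apply/andP; split; lra.
have s0T : s0 < T by rewrite (lt_trans s0t0) // ltrDl.
have start := U_continuous_start R d q b c c0 a T phi lam q_sym' q_psd c_ge' phi2
  phi_gt0 phi_infty phi_super' alpha I alpha0 aTI qh bh ch f K U fc fK Usol' s0
  (`|x0| + 1) (eps / 2) as0 s0T e2.
have {}start := cvg_s _ start.
have /subspace_continuousP Uc := (Usol s0 Is0).1.
have Ucont : \forall p \near (t0, x0), s0 <= p.1 ->
    `|U s0 t0 x0 - U s0 p.1 p.2| <= eps / 2.
  have := Uc (t0, x0) (ltW s0t0).
  move=> /(@cvgrPdist_le _ _ _ (within _ (nbhs (t0, x0))))/(_ _ e2).
  by rewrite near_withinE.
have proj : ((p : R * R * 'rV[R]_d).1.1, p.2) @[p --> (t0, s0, x0)] --> (t0, x0).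
  by apply: (@cvg_pair _ _ _ (nbhs (t0, s0, x0)) (nbhs t0) (nbhs x0)).
have {}Ucont := proj _ Ucont.
have near_s0 : \forall t \near t0, s0 <= t.
  have : \forall t \near t0, s0 < t by exact: lt_nbhsr.
  by apply: filterS => t /ltW.
have near_x0 : \forall x \near x0, `|x0 - x| <= 1.
  by apply: (@cvgr_dist_le _ _ _ (nbhs x0)) => //; exact: cvg_id.
near=> p => -[Ipt Ips pst].
have ap : a <= p.1.2 by move: Ips; near: p.
have pT : p.1.1 <= T by near: p.
have s0p : s0 <= p.1.1 by near: p; exact: cvg_t _ near_s0.
have px : `|p.2| <= `|x0| + 1.
  have : `|x0 - p.2| <= 1 by near: p; exact: cvg_x _ near_x0.
  by have := ler_distD x0 p.2 0; rewrite !subr0 distrC; lra.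
have : s0 <= p.1.1 -> `|U s0 t0 x0 - U s0 p.1.1 p.2| <= eps / 2.
  by near: p; exact: Ucont.
move=> /(_ s0p).
have : a <= p.1.2 -> forall t x, p.1.2 <= t <= T -> s0 <= t ->
    `|x| <= `|x0| + 1 -> `|U p.1.2 t x - U s0 t x| <= eps / 2.
  by near: p; exact: start.
move=> /(_ ap p.1.1 p.2); rewrite pst pT => /(_ isT s0p px).
by rewrite !ler_norml => /andP[u1 u2] /andP[v1 v2]; apply/andP; split; lra.
Unshelve. all: by end_near. Qed.
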